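(* Let $n\ge 1$ and let $T:\mathbb{R}^{n+1}\to\mathbb{R}^{n+1}$ be the multidimensional Hénon map $(x,y)\mapsto(\bar x,\bar y)$ given by $$\bar x=\mu-x^2+\sum_{i=1}^n y_i,\qquad \bar y_1=bx,\qquad \bar y_{i+1}=a_i y_i\quad (i=1,\dots,n-1),$$ where $|b|<1$ and $|a_i|<a<1$ for $i=1,\dots,n-1$. Put $$\alpha=\frac{\mu(1-a)}{1-a-|b|},\qquad \gamma=\frac{\mu|b|}{1-a-|b|},$$ where the parameters are such that $\gamma>0$ and $\alpha>0$. Suppose $$0<\mu<2\left(1-\frac{|b|}{1-a}\right)^2 .$$ Then $T$ has the invariant domain $$D=\{(x,y):\ |x|<\alpha,\ \|y\|<\gamma\}$$ with an attractor $A$.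
   Context: Here $x\in\mathbb{R}$, $y=(y_1,\dots,y_n)\in\mathbb{R}^n$, and $\|y\|=\sum_{i=1}^n|y_i|$. A domain $D$ is invariant if $T(D)\subset D$. That $T$ has an attractor $A$ in a domain $D$ is understood as follows: $T(D)\subset D$, and $A=\lim_{k\to\infty}T^kD=\bigcap_{k\ge0}T^k(D)$ is a nonempty set with $T(A)=A$.
   Formalization: The condition a ≥ 0 is added; it follows from |a_i| < a when n ≥ 2, and for n = 1 (no a_i) the claim fails for every a < 0, since then |b|α > γ and T(D) is not contained in D (e.g. a = −1, b = 1/2, μ = 0.1). *)

(* Defs.v *)
From HB Require Import structures.
From mathcomp Require Import all_boot all_order all_algebra.
From mathcomp Require Import all_classical all_reals all_analysis.

Set Implicit Arguments.
Unset Strict Implicit.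
Unset Printing Implicit Defensive.

Import Order.TTheory GRing.Theory Num.Theory.
Import numFieldNormedType.Exports.

Local Open Scope classical_set_scope.
Local Open Scope ring_scope.

(* The first coordinate is x : R and the remaining coordinates are a row
   vector y with n.+1 >= 1 entries, so that the ambient space has dimension
   n.+2.  Indices are 0-based: the coefficient a i, for i < n, multiplies y_i
   to give the new y_(i+1); no coefficient is left when y is a scalar. *)
Definition henon (R : realType) (n : nat) (mu b : R) (a : 'I_n -> R)
    (p : R * 'rV[R]_n.+1) : R * 'rV[R]_n.+1 :=
  (mu - p.1 ^+ 2 + \sum_(i < n.+1) p.2 ord0 i,
   \row_(j < n.+1) match unlift ord0 j with
                   | None => b * p.1
                   | Some i => a i * p.2 ord0 (widen_ord (leqnSn n) i)
                   end).

(* The library norm on row vectors is the sup norm, hence this definition. *)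
Definition l1norm (R : realType) (m : nat) (y : 'rV[R]_m) : R :=
  \sum_(i < m) `|y ord0 i|.

Definition henon_alpha (R : realType) (mu a b : R) : R :=
  mu * (1 - a) / (1 - a - `|b|).

Definition henon_gamma (R : realType) (mu a b : R) : R :=
  mu * `|b| / (1 - a - `|b|).

Definition henon_domain (R : realType) (n : nat) (alpha gamma : R) :
    set (R * 'rV[R]_n.+1) :=
  [set p | `|p.1| < alpha /\ l1norm p.2 < gamma].

Definition is_domain (X : topologicalType) (D : set X) : Prop :=
  [/\ D !=set0, open D & connected D].

Definition is_invariant_domain (X : topologicalType) (T : X -> X) (D : set X) :
    Prop :=
  is_domain D /\ T @` D `<=` D.

(* Set-theoretic convergence: the upper and the lower limit both equal A. *)
Definition set_limit (X : Type) (F : nat -> set X) (A : set X) : Prop :=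
  \bigcap_k \bigcup_(j in [set j | (k <= j)%N]) F j = A /\
  \bigcup_k \bigcap_(j in [set j | (k <= j)%N]) F j = A.

Definition is_attractor_in (X : Type) (T : X -> X) (D A : set X) : Prop :=
  [/\ T @` D `<=` D,
      set_limit (fun k => iter k T @` D) A,
      A = \bigcap_k (iter k T @` D),
      A !=set0
    & T @` A = A].

(* Main.v *)
Require Import Defs.
From HB Require Import structures.
From mathcomp Require Import all_boot all_order all_algebra.
From mathcomp Require Import all_classical all_reals all_analysis.
From mathcomp Require Import ring lra.

Set Implicit Arguments.
Unset Strict Implicit.
Unset Printing Implicit Defensive.

Import Order.TTheory GRing.Theory Num.Theory.
Import numFieldNormedType.Exports.

Local Open Scope classical_set_scope.
Local Open Scope ring_scope.

(** Write alpha and gamma for the two radii and |y| for the l1 norm of y.  The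
    radii satisfy alpha = mu + gamma and gamma = |b| alpha + a gamma, and the
    upper bound on mu is used only through alpha ^+ 2 < 2 mu.  If (x, y) lies in the closed
    domain, the new first coordinate is at most mu + |y| <= mu + gamma = alpha
    and at least mu - alpha ^+ 2 - gamma > - mu - gamma = - alpha
    ([henon_fst_bounds]); the new second part has norm at most
    |b| |x| + a |y| ([l1norm_henon_le]), which is less than gamma when |x| is
    less than alpha, since b is nonzero.  So the open domain is invariant.

    For an invariant D the images T^k D decrease, so they converge to
    A = \bigcap_k T^k D and T A is contained in A.  What has to be proved is
    that A is nonempty and that A is contained in T A.  As D is open this needs
    an argument, and there are two, according to the number of shift
    coefficients.

    - If there is at least one, then a > 0 and the coefficients are bounded by some
      c < a.  One step then brings the closed domain K into
      |y| <= |b| alpha + c gamma < gamma, and a second step into the open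
      domain, because the first coordinate is at most mu + |y|
      ([henon_closed_domain_step], [henon_attractor_pos]).  Hence D and K have
      the same intersection of images, and for the compact set K both claims
      follow by compactness, applied to the nested sets T^k K and to their
      traces on a fibre of T ([compact_attractor]).

    - If there is none, T is the planar map.  The previous argument may fail
      when a = 0: for b > 0 and mu = (1 - b) ^+ 2 the points (alpha, 0) and
      (0, gamma) of the boundary form a 2-cycle.  But the planar map is
      injective ([planar_henon_injective]), which gives A in T A at once, and
      it has an explicit fixed point in D ([planar_henon_fixed_point]), which
      then belongs to A. *)

(** * Attractors of invariant sets *)

Lemma image_iterS (X : Type) (T : X -> X) (k : nat) (D : set X) :
  iter k.+1 T @` D = T @` (iter k T @` D).
Proof. by rewrite image_comp. Qed.

Lemma image_iterD (X : Type) (T : X -> X) (k m : nat) (D : set X) :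
  iter (k + m) T @` D = iter k T @` (iter m T @` D).
Proof.
by rewrite image_comp; apply: eq_imagel => x _ /=; rewrite iterD.
Qed.

Lemma image_iter_nonincreasing (X : Type) (T : X -> X) (D : set X) :
  T @` D `<=` D ->
  forall j k : nat, (j <= k)%N -> iter k T @` D `<=` iter j T @` D.
Proof.
move=> TD j k /subnKC <-; rewrite image_iterD; apply: image_subset.
elim: (k - j)%N => [|i IHi]; first by rewrite image_id.
by rewrite image_iterS; apply: subset_trans TD; apply: image_subset.
Qed.

Lemma set_limit_nonincreasing (X : Type) (F : nat -> set X) :
  (forall j k : nat, (j <= k)%N -> F k `<=` F j) ->
  set_limit F (\bigcap_k F k).
Proof.
move=> Fdec; split; apply/seteqP; split=> x.
- by move=> Fx k _; have [j /= kj /(Fdec _ _ kj)] := Fx k I.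
- by move=> Fx k _; exists k => //=; exact: Fx.
- move=> [k _ Fx] j _; apply: (Fdec j (maxn j k) (leq_maxl _ _)).
  by apply: Fx => /=; exact: leq_maxr.
- by move=> Fx; exists 0%N => // j _; exact: Fx.
Qed.

(** Invariance already gives the limit and one of the two inclusions in
    T A = A; the two remaining hypotheses are where compactness or injectivity
    enters. *)
Lemma attractor_bigcap (X : Type) (T : X -> X) (D : set X) :
  T @` D `<=` D ->
  \bigcap_k (iter k T @` D) !=set0 ->
  \bigcap_k (iter k T @` D) `<=` T @` (\bigcap_k (iter k T @` D)) ->
  is_attractor_in T D (\bigcap_k (iter k T @` D)).
Proof.
move=> TD A0 AT; have dec := image_iter_nonincreasing TD.
split=> //; first exact: set_limit_nonincreasing.
apply/seteqP; split=> // _ [q Aq <-] k _.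
by apply: (dec _ _ (leqnSn k)); rewrite image_iterS; exists q => //; exact: Aq.
Qed.

(** The only preimage of a point of the intersection serves for every k. *)
Lemma bigcap_iter_injective (X : Type) (T : X -> X) (D : set X) :
  injective T ->
  \bigcap_k (iter k T @` D) `<=` T @` (\bigcap_k (iter k T @` D)).
Proof.
move=> Tinj p Ap; have [q _ Tqp] := Ap 1%N I.
exists q => // k _; have := Ap k.+1 I; rewrite image_iterS => -[r kr].
by rewrite -Tqp => /Tinj <-.
Qed.

(** A cluster point of the filter generated by the sets F k lies in the closure
    of each of them. *)
Lemma compact_nested (X : topologicalType) (F : nat -> set X) :
  compact (F 0%N) -> (forall k, closed (F k)) -> (forall k, F k !=set0) ->
  (forall j k : nat, (j <= k)%N -> F k `<=` F j) ->
  \bigcap_k F k !=set0.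
Proof.
move=> F0 Fcl Fne Fdec.
have FF : ProperFilter (filter_from [set: nat] F).
  apply: filter_from_proper => [|k _]; last exact: Fne.
  apply: filter_from_filter; first by exists 0%N.
  move=> i j _ _; exists (maxn i j) => // x Fx.
  by split; apply: (Fdec _ (maxn i j)) => //; rewrite (leq_maxl, leq_maxr).
have [|x [_ xF]] := F0 _ FF; first by exists 0%N.
exists x => k _; apply: Fcl; move: xF; rewrite clusterE; apply.
by exists k.
Qed.

Lemma continuous_iter (X : topologicalType) (T : X -> X) (k : nat) :
  continuous T -> continuous (iter k T).
Proof.
move=> Tc; elim: k => [|k IHk] x; first exact: cvg_id.
exact: (continuous_comp (IHk x) (Tc _)).
Qed.

(** A point p of the intersection has a preimage in every T^k K; these sets of
    preimages are compact and nested, hence share a point, which is a preimage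
    of p in the intersection. *)
Lemma compact_bigcap_iter (X : topologicalType) (T : X -> X) (K : set X) :
  hausdorff_space X -> continuous T -> compact K -> K !=set0 ->
  T @` K `<=` K ->
  \bigcap_k (iter k T @` K) !=set0 /\
  \bigcap_k (iter k T @` K) `<=` T @` (\bigcap_k (iter k T @` K)).
Proof.
move=> XT2 Tc Kc [z Kz] TK; have dec := image_iter_nonincreasing TK.
have Fc k : compact (iter k T @` K).
  by apply: continuous_compact => //; apply/continuous_subspaceT/continuous_iter.
have Fcl k : closed (iter k T @` K) by exact: compact_closed.
split.
  by apply: compact_nested => // k; exists (iter k T z), z.
move=> p Ap; pose G k := T @^-1` [set p] `&` iter k T @` K.
have pcl : closed (T @^-1` [set p]).
  apply: preimage_closed => //.
  by apply: accessible_closed_set1; exact: hausdorff_accessible.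
have [|k|k|j k jk|q Gq] := @compact_nested _ G.
- apply: (subclosed_compact _ (Fc 0%N)); first exact: closedI.
  by move=> x [].
- exact: closedI.
- by have := Ap k.+1 I; rewrite image_iterS => -[q kq Tq]; exists q.
- by move=> x [? /(dec _ _ jk)].
exists q; last by have [] := Gq 0%N I.
by move=> k _; have [] := Gq k I.
Qed.

(** T^(k + m) K is contained in T^k D, which is contained in T^k K: the images
    of D and of K have the same intersection, although D need not be closed. *)
Lemma compact_attractor (X : topologicalType) (T : X -> X) (D K : set X)
    (m : nat) :
  hausdorff_space X -> continuous T -> compact K -> D !=set0 ->
  D `<=` K -> T @` D `<=` D -> T @` K `<=` K -> iter m T @` K `<=` D ->
  is_attractor_in T D (\bigcap_k (iter k T @` D)).
Proof.
move=> XT2 Tc Kc [z Dz] DK TD TK TmK.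
have [|A0 AT] := compact_bigcap_iter XT2 Tc Kc _ TK; first by exists z; exact: DK.
have E : \bigcap_k (iter k T @` K) = \bigcap_k (iter k T @` D).
  apply/seteqP; split=> p Ap k _; last first.
    by have := Ap k I; exact: image_subset.
  by have := Ap (k + m)%N I; rewrite image_iterD; exact: image_subset.
by apply: attractor_bigcap => //; rewrite -E.
Qed.

(** * Topology of the domain and continuity of the map *)

Section Topology.
Variable R : realType.

Lemma continuous_rV (X : topologicalType) (m : nat) (f : X -> 'rV[R]_m) :
  (forall j, continuous (fun x => f x ord0 j)) -> continuous f.
Proof.
move=> fc x A [P Px PA].
have : \forall y \near x, forall j, P ord0 j (f y ord0 j).
  by apply: filter_forall => j; apply: fc; exact: Px.
by apply: filterS => y Py; apply: PA => i j; rewrite (ord1 i).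
Qed.

Lemma continuous_l1norm (m : nat) : continuous (@l1norm R m).
Proof.
apply: continuous_big => [|i _]; first exact: add_continuous.
move=> y; apply: (continuous_comp (@coord_continuous R 1 m ord0 i y)).
exact: norm_continuous.
Qed.

Lemma continuous_henon (n : nat) (mu b : R) (ai : 'I_n -> R) :
  continuous (henon mu b ai).
Proof.
have xc : continuous (fun p : R * 'rV[R]_n.+1 => p.1).
  by move=> p; exact: cvg_fst.
have yc j : continuous (fun p : R * 'rV[R]_n.+1 => p.2 ord0 j).
  move=> p; apply: (@continuous_comp _ _ _ snd (fun y : 'rV[R]_n.+1 => y ord0 j)).
    exact: cvg_snd.
  exact: coord_continuous.
have fst_c : continuous (fun p => (henon mu b ai p).1).
  move=> p; apply: cvgD; last first.
    apply: (@continuous_big R _ +%R 0 xpredT) => // z; exact: add_continuous.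
  by apply: cvgB; [exact: cvg_cst | apply: cvgM; exact: xc].
have snd_c : continuous (fun p => (henon mu b ai p).2).
  apply: continuous_rV => j.
  under eq_fun do rewrite mxE.
  case: (unlift ord0 j) => [i|] p; apply: cvgM; try exact: cvg_cst.
    exact: yc.
  exact: xc.
by move=> p; exact: cvg_pair (fst_c p) (snd_c p).
Qed.

Lemma open_henon_domain (n : nat) (alpha gamma : R) :
  open (@henon_domain R n alpha gamma).
Proof.
apply: openI.
  apply: (@open_comp _ _ (fun p : R * 'rV[R]_n.+1 => `|p.1|)
            [set r | r < alpha]); last exact: open_lt.
  move=> p _; apply: (@continuous_comp _ R R fst (fun x : R => `|x|)).
    exact: cvg_fst.
  exact: norm_continuous.
apply: (@open_comp _ _ (fun p : R * 'rV[R]_n.+1 => l1norm p.2)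
          [set r | r < gamma]); last exact: open_lt.
move=> p _; apply: (@continuous_comp _ _ _ snd (@l1norm R n.+1)).
  exact: cvg_snd.
exact: continuous_l1norm.
Qed.

Lemma connected_starshaped (V : normedModType R) (D : set V) :
  (forall (t : R) p, 0 <= t <= 1 -> D p -> D (t *: p)) -> connected D.
Proof.
move=> Dstar.
have -> : D = \bigcup_(p in D) ((fun t : R => t *: p) @` `[0, 1]).
  apply/seteqP; split=> [p Dp|_ [p Dp [t /= t01 <-]]].
    by exists p => //; exists 1; rewrite ?scale1r //= in_itv /= ler01 lexx.
  by apply: Dstar => //; move: t01; rewrite in_itv.
apply: bigcup_connected.
  exists 0 => p Dp; exists 0; rewrite ?scale0r //= in_itv /= lexx ler01 //.
move=> p Dp; apply: connected_continuous_connected; first exact: segment_connected.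
by apply: continuous_subspaceT => t; exact: scalel_continuous.
Qed.

Lemma l1normZ (m : nat) (t : R) (y : 'rV[R]_m) :
  l1norm (t *: y) = `|t| * l1norm y.
Proof.
by rewrite /l1norm mulr_sumr; apply: eq_bigr => i _; rewrite mxE normrM.
Qed.

Lemma l1norm0 (m : nat) : l1norm (0 : 'rV[R]_m) = 0.
Proof. by rewrite /l1norm big1 // => i _; rewrite mxE normr0. Qed.

Lemma ler_sum_l1norm (m : nat) (y : 'rV[R]_m) :
  `|\sum_(i < m) y ord0 i| <= l1norm y.
Proof. exact: ler_norm_sum. Qed.

Lemma l1norm_ge0 (m : nat) (y : 'rV[R]_m) : 0 <= l1norm y.
Proof. exact: sumr_ge0. Qed.

Lemma connected_henon_domain (n : nat) (alpha gamma : R) :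
  connected (@henon_domain R n alpha gamma).
Proof.
apply: (@connected_starshaped (R * 'rV[R]_n.+1)%type) => t [x y] /andP[t0 t1].
rewrite /henon_domain /= => -[xa yg]; rewrite l1normZ normrM ger0_norm //.
split; [apply: le_lt_trans xa | apply: le_lt_trans yg]; apply: ler_piMl => //.
exact: l1norm_ge0.
Qed.

Lemma compact_closed_henon_domain (n : nat) (alpha gamma : R) :
  compact [set p : R * 'rV[R]_n.+1 | `|p.1| <= alpha /\ l1norm p.2 <= gamma].
Proof.
have -> : [set p : R * 'rV[R]_n.+1 | `|p.1| <= alpha /\ l1norm p.2 <= gamma] =
    `[- alpha, alpha] `*` [set y | l1norm y <= gamma].
  by apply/seteqP; split=> -[x y] /=; rewrite in_itv /= ler_norml.
apply: compact_setX; first exact: segment_compact.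
have Q := @rV_compact R n.+1 (fun=> `[- gamma, gamma]%classic)
  (fun=> @segment_compact R (- gamma) gamma).
apply: (subclosed_compact _ Q).
  apply: (preimage_closed _ (@closed_le R gamma)) => z _.
  exact: continuous_l1norm.
move=> y /= yg i; rewrite in_itv /= -ler_norml; apply: le_trans yg.
by rewrite /l1norm (bigD1 i) //= lerDl sumr_ge0.
Qed.

End Topology.

(** * Estimates for one step of the map *)

Section Henon.
Variables (R : realType) (n : nat) (mu b a : R) (ai : 'I_n -> R).

(** The coordinate of y that is shifted out only contributes to the slack. *)
Lemma l1norm_henon_le (c : R) (p : R * 'rV[R]_n.+1) :
  0 <= c -> (forall i, `|ai i| <= c) ->
  l1norm (henon mu b ai p).2 <= `|b| * `|p.1| + c * l1norm p.2.
Proof.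
move=> c0 aic; rewrite /l1norm big_ord_recl mxE unlift_none normrM lerD2l.
rewrite mulr_sumr [leRHS]big_ord_recr /= ler_wpDr ?mulr_ge0 //.
apply: ler_sum => i _; rewrite mxE liftK normrM; exact: ler_wpM2r.
Qed.

Hypotheses (ha1 : a < 1) (hmu0 : 0 < mu).
Hypotheses (hgamma : 0 < henon_gamma mu a b) (halpha : 0 < henon_alpha mu a b).

Lemma henon_gap_gt0 : 0 < 1 - a - `|b|.
Proof.
have num_gt0 : 0 < mu * (1 - a) by rewrite mulr_gt0 // subr_gt0.
by move: halpha; rewrite /henon_alpha pmulr_rgt0 // invr_gt0.
Qed.

Lemma henon_b_neq0 : b != 0.
Proof.
apply: contraTneq hgamma => ->.
by rewrite /henon_gamma normr0 mulr0 mul0r ltxx.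
Qed.

Lemma henon_alphaE : henon_alpha mu a b = mu + henon_gamma mu a b.
Proof.
rewrite /henon_alpha /henon_gamma; field.
exact: lt0r_neq0 henon_gap_gt0.
Qed.

Lemma henon_gammaE :
  henon_gamma mu a b = `|b| * henon_alpha mu a b + a * henon_gamma mu a b.
Proof.
rewrite /henon_alpha /henon_gamma; field.
exact: lt0r_neq0 henon_gap_gt0.
Qed.

Hypothesis hmu : mu < 2 * (1 - `|b| / (1 - a)) ^+ 2.

(** With t = 1 - |b| / (1 - a) one has alpha * t = mu, so that the bound
    mu < 2 t ^+ 2 says mu ^+ 2 / t ^+ 2 < 2 mu. *)
Lemma henon_alpha_sqr_lt : henon_alpha mu a b ^+ 2 < 2 * mu.
Proof.
have gap := henon_gap_gt0; have a1 : 0 < 1 - a by rewrite subr_gt0.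
have E : henon_alpha mu a b * (1 - `|b| / (1 - a)) = mu.
  rewrite /henon_alpha; field.
  by rewrite !lt0r_neq0.
move: hmu; set t := 1 - _ / _ in E * => mut.
have t0 : 0 < t by rewrite -(pmulr_rgt0 _ halpha) E.
rewrite -(ltr_pM2r (exprn_gt0 2 t0)) -exprMn E.
by have := ltr_pM2l hmu0 mu (2 * t ^+ 2); rewrite mut; lra.
Qed.

(** The upper bound keeps the norm of y instead of replacing it by gamma: it is
    then strict as soon as this norm is less than gamma, even when |x| is not
    less than alpha. *)
Lemma henon_fst_bounds (p : R * 'rV[R]_n.+1) :
  `|p.1| <= henon_alpha mu a b -> l1norm p.2 <= henon_gamma mu a b ->
  - henon_alpha mu a b < (henon mu b ai p).1 <= mu + l1norm p.2.
Proof.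
case: p => x y /=; rewrite ler_norml => /andP[xl xu] yg.
have := ler_sum_l1norm y; rewrite ler_norml => /andP[sl su].
have := henon_alpha_sqr_lt; have := henon_alphaE => aE a2.
have x2 : x ^+ 2 <= henon_alpha mu a b ^+ 2 by nra.
have x0 : 0 <= x ^+ 2 by exact: sqr_ge0.
by apply/andP; split; lra.
Qed.

Hypotheses (ha0 : 0 <= a) (hai : forall i, `|ai i| < a).

Lemma henon_domain_invariant :
  henon mu b ai @` henon_domain (henon_alpha mu a b) (henon_gamma mu a b)
    `<=` henon_domain (henon_alpha mu a b) (henon_gamma mu a b).
Proof.
move=> _ [p [xa yg] <-]; split.
  rewrite ltr_norml; have /andP[-> xu] := henon_fst_bounds (ltW xa) (ltW yg).
  by rewrite henon_alphaE (le_lt_trans xu) // ltrD2l.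
have /le_lt_trans -> // := l1norm_henon_le p ha0 (fun i => ltW (hai i)).
rewrite [ltRHS]henon_gammaE ltr_leD //; last by rewrite ler_wpM2l // ltW.
by rewrite ltr_pM2l // normr_gt0 henon_b_neq0.
Qed.

(** Finitely many coefficients, each less than a > 0 in absolute value, are
    bounded by a common c < a.  This gap makes the contraction of y strict up
    to the boundary, but the first coordinate may still reach alpha after one
    step: it does so from (0, y) when the entries of y are nonnegative and sum
    to gamma. *)
Lemma henon_closed_domain_step : 0 < a ->
  exists2 g, g < henon_gamma mu a b &
    forall p : R * 'rV[R]_n.+1,
      `|p.1| <= henon_alpha mu a b -> l1norm p.2 <= henon_gamma mu a b ->
      `|(henon mu b ai p).1| <= henon_alpha mu a b /\
      l1norm (henon mu b ai p).2 <= g.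
Proof.
move=> a0; pose c := \big[Order.max/0]_i `|ai i|.
have ca : c < a by apply: bigmax_lt.
have c0 : 0 <= c by exact: bigmax_ge_id.
exists (`|b| * henon_alpha mu a b + c * henon_gamma mu a b).
  by rewrite [ltRHS]henon_gammaE ltrD2l ltr_pM2r.
move=> p xa yg; split.
  have /andP[xl xu] := henon_fst_bounds xa yg.
  by rewrite ler_norml ltW //= (le_trans xu) // henon_alphaE lerD2l.
apply: le_trans (l1norm_henon_le p c0 _) _.
  by move=> i; exact: (le_bigmax _ (fun i => `|ai i|)).
by rewrite lerD // ler_wpM2l.
Qed.

(** * The attractor *)

(** The closed domain enters the open one after two steps: the first makes the
    norm of y less than gamma, and this makes the first coordinate less than
    alpha at the second. *)
Lemma henon_attractor_pos : 0 < a ->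
  exists A, is_attractor_in (henon mu b ai)
    (henon_domain (henon_alpha mu a b) (henon_gamma mu a b)) A.
Proof.
move=> a0; have [g gg step] := henon_closed_domain_step a0.
eexists.
apply: (compact_attractor (m := 2) _ (@continuous_henon R n mu b ai)
  (@compact_closed_henon_domain R n (henon_alpha mu a b)
     (henon_gamma mu a b))).
- exact: (@norm_hausdorff R (R * 'rV[R]_n.+1)%type).
- by exists 0; rewrite /henon_domain /= normr0 l1norm0.
- by move=> p [/ltW xa /ltW yg].
- exact: henon_domain_invariant.
- move=> _ [p [xa yg] <-]; have [? yg'] := step p xa yg.
  by split=> //; rewrite (le_trans yg') // ltW.
- move=> _ [p [xa yg] <-] /=; have [xa1 yg1] := step p xa yg.
  have yg1' := le_trans yg1 (ltW gg).
  have [_ yg2] := step _ xa1 yg1'; split; last exact: le_lt_trans gg.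
  have /andP[xl xu] := henon_fst_bounds xa1 yg1'.
  rewrite ltr_norml xl henon_alphaE (le_lt_trans xu) // ltrD2l.
  exact: le_lt_trans gg.
Qed.

End Henon.

Lemma planar_henon_injective (R : realType) (mu b : R) (ai : 'I_0 -> R) :
  b != 0 -> injective (henon mu b ai).
Proof.
move=> b0 [x y] [x' y'] [] /=; rewrite !big_ord1 => eqx.
move/rowP/(_ ord0); rewrite !mxE unlift_none => /(mulfI b0) xx'.
move: eqx; rewrite xx' => /addrI yy'; congr pair.
by apply/rowP => j; rewrite (ord1 j).
Qed.

(** The fixed points are (x, b x) with x a root of X^2 + (1 - b) X - mu.  The
    positive root is less than alpha because this polynomial increases on the
    positive axis and is positive at alpha, where (1 - |b|) alpha = mu + a gamma
    is at least mu. *)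
Lemma planar_henon_fixed_point (R : realType) (mu b a : R) (ai : 'I_0 -> R) :
  0 <= a -> a < 1 -> 0 < mu -> 0 < henon_gamma mu a b ->
  0 < henon_alpha mu a b ->
  exists2 p, henon_domain (henon_alpha mu a b) (henon_gamma mu a b) p &
    henon mu b ai p = p.
Proof.
move=> a0 a1 mu0 g0 al0.
have aE := henon_alphaE a1 mu0 al0; have gE := henon_gammaE a1 mu0 al0.
have gap := henon_gap_gt0 a1 mu0 al0; have b0 := henon_b_neq0 g0.
set al := henon_alpha _ _ _ in al0 aE gE *.
set ga := henon_gamma _ _ _ in g0 aE gE *.
pose s := Num.sqrt ((1 - b) ^+ 2 + 4 * mu).
have s0 : 0 <= s by exact: sqrtr_ge0.
have sE : s ^+ 2 = (1 - b) ^+ 2 + 4 * mu.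
  by rewrite sqr_sqrtr // addr_ge0 ?sqr_ge0 // mulr_ge0 // ltW.
pose x := (s - (1 - b)) / 2.
have xE : x ^+ 2 + (1 - b) * x = mu by rewrite /x; lra.
have bb : b <= `|b| by exact: ler_norm.
have x0 : 0 < x by rewrite /x; nra.
have xal : x < al by rewrite ltNge; apply/negP => alx; nra.
clearbody x; exists (x, const_mx (b * x)).
  rewrite /henon_domain /l1norm /= big_ord1 mxE normrM (gtr0_norm x0).
  split=> //; rewrite gE.
  apply: ltr_wpDr; first by rewrite mulr_ge0 // ltW.
  by rewrite ltr_pM2l ?normr_gt0.
congr pair => /=; first by rewrite big_ord1 mxE; lra.
by apply/rowP => j; rewrite !mxE (ord1 j) unlift_none.
Qed.

Lemma planar_henon_attractor (R : realType) (mu b a : R) (ai : 'I_0 -> R) :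
  0 <= a -> a < 1 -> 0 < mu -> 0 < henon_gamma mu a b ->
  0 < henon_alpha mu a b ->
  henon mu b ai @` henon_domain (henon_alpha mu a b) (henon_gamma mu a b)
    `<=` henon_domain (henon_alpha mu a b) (henon_gamma mu a b) ->
  exists A, is_attractor_in (henon mu b ai)
    (henon_domain (henon_alpha mu a b) (henon_gamma mu a b)) A.
Proof.
move=> a0 a1 mu0 g0 al0.
set D := henon_domain _ _ => TD.
have [p Dp Tp] := planar_henon_fixed_point ai a0 a1 mu0 g0 al0.
exists (\bigcap_k (iter k (henon mu b ai) @` D)); apply: attractor_bigcap => //.
  by exists p => k _; exists p => //; elim: k => //= k ->.
by apply/bigcap_iter_injective/planar_henon_injective/(henon_b_neq0 g0).
Qed.

Theorem theorem2 (R : realType) (n : nat) (mu b a : R) (ai : 'I_n -> R)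
    (hb : `|b| < 1)
    (hai : forall i : 'I_n, `|ai i| < a)
    (ha0 : 0 <= a) (ha1 : a < 1)
    (hgamma : 0 < henon_gamma mu a b)
    (halpha : 0 < henon_alpha mu a b)
    (hmu0 : 0 < mu)
    (hmu : mu < 2 * (1 - `|b| / (1 - a)) ^+ 2) :
  let T := henon mu b ai in
  let D : set (R * 'rV[R]_n.+1) :=
    henon_domain (henon_alpha mu a b) (henon_gamma mu a b) in
  is_invariant_domain T D /\
  exists A : set (R * 'rV[R]_n.+1), is_attractor_in T D A.
Proof.
move=> T D; have TD : T @` D `<=` D by exact: henon_domain_invariant.
split; first split=> //; first split.
- by exists 0; rewrite /D /henon_domain /= normr0 l1norm0.
- exact: open_henon_domain.
- exact: connected_henon_domain.
rewrite /T /D in TD *; case: n ai hai {T D} TD => [|n] ai hai TD.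
  exact: planar_henon_attractor TD.
have a0 : 0 < a by exact: le_lt_trans (hai ord0).
exact: henon_attractor_pos.
Qed.
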